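(* Let $G$ be a finitely generated group that admits a regular positive cone, and let $H$ be a finite index subgroup of $G$. Then $H$ also admits a regular positive cone.
   Context: A positive cone of a group $G$ is a subset $P\subseteq G$ such that $PP\subseteq P$ and $G=P\sqcup P^{-1}\sqcup\{1\}$ (disjoint union). (Positive cones correspond exactly to left-invariant strict total orders $\prec$ on $G$, via $P=\{g : g\succ 1\}$.) For a finite set $X$, $X^*$ is the free monoid of words over $X$; a language over $X$ is a subset of $X^*$, and it is regular if it is accepted by a finite state automaton. If $G=\langle X\rangle$, the evaluation map $\pi:X^*\to G$ is the monoid homomorphism sending a word to the element of $G$ it represents. A positive cone $P$ of a finitely generated group $G$ is a regular positive cone if there exist a finite generating set $X$ of $G$ and a regular language $L\subseteq X^*$ such that $\pi(L)=P$. *)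

(* Defs.v *)
From HB Require Import structures.
From mathcomp Require Import all_boot finmap.
From mathcomp Require Import boolp classical_sets cardinality.

Set Implicit Arguments.
Unset Strict Implicit.
Unset Printing Implicit Defensive.

Local Open Scope classical_set_scope.
Local Open Scope group_scope.

(* Automata are deterministic, with a total transition function. *)
Record dfa (A : Type) := Dfa {
  dfa_state : finType;
  dfa_init : dfa_state;
  dfa_accept : {set dfa_state};
  dfa_trans : dfa_state -> A -> dfa_state
}.

Definition dfa_lang (A : Type) (M : dfa A) : set (seq A) :=
  [set w | foldl (dfa_trans (d := M)) (dfa_init M) w \in dfa_accept M].

Definition regular (A : finType) (L : set (seq A)) : Prop :=
  exists M : dfa A, dfa_lang M = L.

Definition generated_subgroup (G : groupType) (X : set G) : set G :=
  smallest [set K : set G | group_closed (mem K)] X.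

Definition generates (G : groupType) (X : {fset G}) : Prop :=
  generated_subgroup [set` X] = [set: G].

Definition finitely_generated (G : groupType) : Prop :=
  exists X : {fset G}, generates X.

(* Words over X are sequences on the finite type X of elements of the finite
   set; inverses of generators are not implicitly available as letters. *)
Definition word_eval (G : groupType) (X : {fset G}) (w : seq X) : G :=
  \prod_(x <- w) val x.

Definition positive_cone (G : groupType) (P : set G) : Prop :=
  let Pinv := [set x^-1 | x in P] in
  [/\ [set x * y | x in P & y in P] `<=` P,
      P `|` Pinv `|` [set 1] = [set: G]
    & [/\ P `&` Pinv = set0, P `&` [set 1] = set0 & Pinv `&` [set 1] = set0]].

Definition regular_positive_cone (G : groupType) (P : set G) : Prop :=
  positive_cone P /\
  exists X : {fset G}, generates X /\
  exists L : set (seq X), regular L /\ @word_eval G X @` L = P.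

Definition admits_regular_positive_cone (G : groupType) : Prop :=
  exists P : set G, regular_positive_cone P.

Definition left_coset (G : groupType) (S : pred G) (g : G) : set G :=
  [set g * h | h in [set` S]].

Definition finite_index (G : groupType) (S : pred G) : Prop :=
  finite_set (range (left_coset S)).

(* Main.v *)
Require Import Defs.
From HB Require Import structures.
From mathcomp Require Import all_boot finmap.
From mathcomp Require Import boolp classical_sets cardinality.

(** A positive cone [P] of [G] restricts to the positive cone of elements of
    [H] that lie in [P]; the point is to describe this restriction by a regular
    language over generators of [H], and this is Reidemeister-Schreier
    rewriting.  Choose representatives, finitely many because the index is
    finite, of the cosets [S g], with [1] representing [S] itself, and write
    [rep g] for that of [g].  While a word [x_1 ... x_n] over the generators of
    [G] is being read, keep track of the representative [t_i] of its prefix of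
    length [i], and replace the letter [x_i] by the Schreier element
    [t_(i-1) x_i t_i^-1], which belongs to [S].  The product of these elements
    telescopes to [x_1 ... x_n t_n^-1], and when the word represents an element
    of [S] one has [t_n = 1]: the rewritten word then represents the same
    element as the original one ([word_eval_transduce]).

    The rewriting is carried out letter by letter by a finite-state transducer,
    and such transducers send regular languages to regular languages
    ([regular_transduce]).  Hence rewriting the words of the given language
    that represent elements of [S] yields a regular language whose evaluation
    is the restricted cone.  The letters used generate [H] without further
    work, since every element of [H] is [1], positive, or the inverse of a
    positive element ([positive_cone_generates]). *)

Set Implicit Arguments.
Unset Strict Implicit.
Unset Printing Implicit Defensive.

Local Open Scope classical_set_scope.
Local Open Scope group_scope.

Section Transducer.

Context (Q A B : Type) (step : Q -> A -> Q) (out : Q -> A -> B).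

Fixpoint transduce (q : Q) (w : seq A) : seq B :=
  if w is x :: v then out q x :: transduce (step q x) v else [::].

End Transducer.

(** The image automaton guesses the input letter behind each output letter; it
    is made deterministic by the subset construction, a state being the set of
    pairs (transducer state, automaton state) compatible with what was read. *)
Lemma regular_transduce (Q A B : finType) (step : Q -> A -> Q)
    (out : Q -> A -> B) (q0 : Q) (F : pred Q) (L : set (seq A)) :
  regular L ->
  regular [set transduce step out q0 w | w in L `&` [set w | F (foldl step q0 w)]].
Proof.
move=> [M <-].
pose next (U : {set Q * dfa_state M}) (b : B) : {set Q * dfa_state M} :=
  finset (fun p => [exists s in U, exists x,
    (out s.1 x == b) && (p == (step s.1 x, dfa_trans s.2 x))]).
pose acc : {set {set Q * dfa_state M}} :=
  finset (fun U : {set Q * dfa_state M} =>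
    [exists s in U, F s.1 && (s.2 \in dfa_accept M)]).
exists (Dfa (finset.set1 (q0, dfa_init M)) acc next).
have reachP v (U : {set Q * dfa_state M}) p : reflect
    (exists s w, [/\ s \in U, transduce step out s.1 w = v &
       p = (foldl step s.1 w, foldl (@dfa_trans _ M) s.2 w)])
    (p \in foldl next U v).
  elim: v U => [|b v IHv] U /=.
    apply: (iffP idP) => [pU|[s [[|x w] [sU //= _ ->]]]]; last by case: s sU.
    by exists p, [::]; split=> //; case: (p).
  apply: (iffP (IHv _)) => [[s [w [+ <- ->]]]|[s [[//|x w] [sU //= [<- <-] ->]]]].
    rewrite inE => /existsP[s' /andP[s'U /existsP[x /andP[/eqP <- /eqP ->]]]].
    by exists s', (x :: w).
  exists (step s.1 x, dfa_trans s.2 x), w; split=> //.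
  rewrite inE; apply/existsP; exists s; rewrite sU /=.
  by apply/existsP; exists x; rewrite !eqxx.
apply/seteqP; split=> [v|_ [w [Lw Fw] <-]]; rewrite /dfa_lang /= inE.
  case/existsP=> p /andP[/reachP[s [w [+ <- ->]]] /= /andP[Fw Lw]].
  by rewrite inE => /eqP sE; rewrite sE /= in Fw Lw *; exists w.
apply/existsP; exists (foldl step q0 w, foldl (@dfa_trans _ M) (dfa_init M) w).
rewrite /= Fw Lw !andbT; apply/reachP; exists (q0, dfa_init M), w.
by rewrite inE.
Qed.

Lemma positive_cone_preimage (G H : groupType) (f : UMagmaMorphism.type H G)
    (P : set G) :
  injective f -> positive_cone P -> positive_cone (f @^-1` P).
Proof.
move=> f_inj [PM Ptot [PV0 P10 PV10]].
have P'V y : [set x^-1 | x in f @^-1` P] y -> [set x^-1 | x in P] (f y).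
  by case=> x Px <-; exists (f x); rewrite ?gmulfV.
split.
- move=> _ [x Px] [y Py <-]; rewrite /= gmulfM.
  by apply: PM; exists (f x) => //; exists (f y).
- apply/seteqP; split=> // y _.
  have: [set: G] (f y) by [].
  rewrite -Ptot => -[[|[x Px xE]]|/=]; first by left; left.
    left; right; exists y^-1; last by rewrite invgK.
    by rewrite /= gmulfV -xE invgK.
  by rewrite -(gmulf1 (s:=f)) => /f_inj; right.
split; apply/seteqP; split=> // y [].
- by move=> Py /P'V PVy; have: set0 (f y) by rewrite -PV0; split.
- by move=> Py /= y1; have: set0 (f y) by rewrite -P10; split; rewrite //= y1 gmulf1.
- by move=> /P'V PVy /= y1; have: set0 (f y) by rewrite -PV10; split; rewrite //= y1 gmulf1.
Qed.

Lemma positive_cone_generates (G : groupType) (P : set G) (X : {fset G})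
    (L : set (seq X)) :
  positive_cone P -> @word_eval G X @` L = P -> generates X.
Proof.
move=> [_ Ptot _] LP; apply/seteqP; split=> // g _ K [Kgrp XK].
have [K1 _] := Kgrp.
have KV := group_closedV Kgrp; have KM := group_closedM Kgrp.
have Kword w : @word_eval G X w \in K.
  rewrite /word_eval; elim: w => [|x w IHw]; first by rewrite big_nil.
  by rewrite big_cons KM // inE; apply: XK; apply: valP.
have PK x : P x -> x \in K by rewrite -LP => -[w _ <-].
have: [set: G] g by [].
rewrite -Ptot => -[[/PK gK|[x /PK xK <-]]|->]; apply: set_mem => //.
exact: KV.
Qed.

Lemma subgroup_closed (G : groupType) (S : pred G) (H : subGroupType S) :
  group_closed S.
Proof.
split=> [|x y xS yS]; first by rewrite -(val1 H); apply: valP.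
by rewrite -(SubK H xS) -(SubK H yS) -gmulfF; apply: valP.
Qed.

(** The left coset of [g^-1] is the inverse of [S g]; so the finiteness of the
    set of left cosets provides finitely many representatives of the cosets
    [S g]. *)
Lemma finite_index_representatives (G : groupType) (S : pred G) :
  group_closed S -> finite_index S ->
  exists (T : {fset G}) (rep : G -> T),
    (forall g, g * (val (rep g))^-1 \in S) /\
    (forall t : T, val t \in S -> val t = 1).
Proof.
move=> Sgrp Sfin; have [S1 _] := Sgrp; have SM := group_closedM Sgrp.
pose choose (C : set G) : G := if `[< C 1 >] then 1 else (xget 1 C)^-1.
pose r g := choose (left_coset S g^-1).
have rS g : g * (r g)^-1 \in S.
  rewrite /r /choose; case: asboolP => [[h hS gh1]|_].
    by rewrite invg1 -gh1 mulVKg.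
  rewrite invgK; have : left_coset S g^-1 (xget 1 (left_coset S g^-1)).
    by apply: xgetPex; exists (g^-1 * 1), 1.
  by case=> h hS <-; rewrite mulVKg.
have r1 g : r g \in S -> r g = 1.
  move=> rgS; rewrite {1}/r /choose; case: asboolP => // -[].
  exists g; last exact: mulVg.
  by rewrite /= -(mulgVK (r g) g) SM.
have rfin : finite_set (range r).
  have -> : range r = choose @` range (left_coset S).
    apply/seteqP; split=> [_ [g _ <-]|_ [_ [g _ <-] <-]].
      by exists (left_coset S g^-1) => //; exists g^-1.
    by exists g^-1 => //; rewrite /r invgK.
  exact: finite_image.
have [T TE] := finite_fsetP.1 rfin.
have rT g : r g \in T.
  by have : range r (r g) by [exists g]; rewrite TE.
exists T, (fun g => [` rT g]%fset); split=> //= t tS.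
have : [set` T] (val t) by exact: valP.
by rewrite -TE => -[g _ gt]; move: tS; rewrite -gt; apply: r1.
Qed.

Lemma fset_codomain (I : finType) (K : choiceType) (f : I -> K) :
  exists (Y : {fset K}) (g : I -> Y), forall i, val (g i) = f i.
Proof.
have fY i : f i \in [fset x in codom f]%fset by rewrite inE codom_f.
by exists [fset x in codom f]%fset, (fun i => [` fY i]%fset).
Qed.

(** The intermediate representatives [val (step t x)] cancel, as each one ends
    a letter of the rewritten word and begins the next. *)
Lemma word_eval_transduce (G H : groupType) (f : UMagmaMorphism.type H G)
    (T X : {fset G}) (Y : {fset H}) (step : T -> X -> T) (out : T -> X -> Y) :
  (forall t x, f (val (out t x)) = val t * val x * (val (step t x))^-1) ->
  forall t w, f (word_eval (transduce step out t w)) =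
    val t * word_eval w * (val (foldl step t w))^-1.
Proof.
move=> outE t w; rewrite /word_eval; elim: w t => [|x w IHw] t /=.
  by rewrite !big_nil gmulf1 mulg1 mulgV.
by rewrite !big_cons gmulfM IHw outE !mulgA mulgVK.
Qed.

Theorem theorem1p1 (G : groupType) (S : pred G) (H : subGroupType S) :
  finitely_generated G ->
  admits_regular_positive_cone G ->
  finite_index S ->
  admits_regular_positive_cone H.
Proof.
move=> _ [P [Pcone [X [_ [L [Lreg LP]]]]]] Sfin.
have Sgrp := subgroup_closed H.
have [S1 _] := Sgrp; have SM := group_closedM Sgrp.
have SV := group_closedV Sgrp.
have [T [rep [repS rep1]]] := finite_index_representatives Sgrp Sfin.
pose step (t : T) (x : X) := rep (val t * val x).
pose schreier (p : T * X) : H :=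
  insubd 1 (val p.1 * val p.2 * (val (step p.1 p.2))^-1).
have [Y [letter letterE]] := fset_codomain schreier.
pose out t x := letter (t, x).
have outE t x : val (val (out t x)) = val t * val x * (val (step t x))^-1.
  by rewrite letterE insubdK.
have evalE := word_eval_transduce outE.
have rep_1 : val (rep 1) = 1.
  by apply: rep1; have := SV _ (repS 1); rewrite mul1g invgK.
pose L' := [set transduce step out (rep 1) w |
  w in L `&` [set w | val (foldl step (rep 1) w) == 1]].
have L'reg : regular L' by exact: (regular_transduce step out (rep 1) (fun t => val t == 1) Lreg).
have Qcone : positive_cone (val @^-1` P : set H).
  exact: positive_cone_preimage val_inj Pcone.
have L'Q : @word_eval H Y @` L' = val @^-1` P.
  apply/seteqP; split=> [_ [_ [w [Lw /eqP wE] <-] <-]|h Ph] /=.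
    by rewrite evalE rep_1 wE mul1g invg1 mulg1 -LP; exists w.
  have [w Lw wh] : (@word_eval G X @` L) (val h) by rewrite LP.
  have := evalE (rep 1) w; rewrite rep_1 mul1g wh => hE.
  (* The output lies in [H], so the last representative [t] is in [S]:
     [t^-1] is [(val h)^-1] times the value of the output. *)
  have wE : val (foldl step (rep 1) w) = 1.
    apply: rep1; rewrite -[val _]invgK SV // -(mulKg (val h) _^-1) -hE.
    by apply: SM; [apply: SV|]; apply: valP.
  exists (transduce step out (rep 1) w); first by exists w; split=> //=; apply/eqP.
  by apply: val_inj; rewrite hE wE invg1 mulg1.
exists (val @^-1` P); split=> //; exists Y; split.
  exact: positive_cone_generates Qcone L'Q.
by exists L'.
Qed.
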